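(* Consider the single reaction $A_1+A_2\leftrightharpoons A_3$ with unit rate constants, and let $M_{13},M_{23}>0$ and $c_{1\infty},c_{2\infty},c_{3\infty}>0$ be as in the context. There exists a constructive (explicitly computable) constant $C_0>0$, only depending on $c_{i\infty}$ and on upper bounds of $\overline{c_i}$ ($i=1,2,3$), such that $$\big(\sqrt{\overline{c_1}}\sqrt{\overline{c_2}}-\sqrt{\overline{c_3}}\sqrt{\overline c}\big)^2\ge C_0\sum_{i=1}^3\big(\sqrt{\overline{c_i}}-\sqrt{c_{i\infty}}\big)^2$$ for all nonnegative numbers $\overline{c_1},\overline{c_2},\overline{c_3},\overline c$ satisfying $$\overline{c_1}+\overline{c_3}=M_{13}=c_{1\infty}+c_{3\infty},\qquad\overline{c_2}+\overline{c_3}=M_{23}=c_{2\infty}+c_{3\infty},\qquad\overline{c_1}+\overline{c_2}+\overline{c_3}=\overline c.$$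
   Context: $M_1,M_2,M_3>0$ are molar masses with $M_1+M_2=M_3$, and $M_{13},M_{23}>0$ satisfy $M_1M_{13}+M_2M_{23}=1$. $\boldsymbol x_\infty=(x_{1\infty},x_{2\infty},x_{3\infty})\in(0,1)^3$ is the unique detailed-balanced equilibrium, i.e. $$x_{1\infty}x_{2\infty}=x_{3\infty},\quad x_{1\infty}+x_{2\infty}+x_{3\infty}=1,\quad c_{1\infty}+c_{3\infty}=M_{13},\quad c_{2\infty}+c_{3\infty}=M_{23},$$ where $c_{i\infty}=c_\infty x_{i\infty}$ and $c_\infty=(M_1x_{1\infty}+M_2x_{2\infty}+M_3x_{3\infty})^{-1}$. (Hence $c_\infty=c_{1\infty}+c_{2\infty}+c_{3\infty}$.) *)

(* Defs.v *)
From Stdlib Require Import Reals ZArith.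
Open Scope R_scope.

Inductive species : Set := Sp1 | Sp2 | Sp3.

Definition sum_species (f : species -> R) : R := f Sp1 + f Sp2 + f Sp3.

(* Total concentration determined by the mole fractions [x], from the
   normalisation of the mass density to one: sum_i M_i c_i = 1. *)
Definition total_conc (M x : species -> R) : R :=
  / sum_species (fun i => M i * x i).

Definition conc (M x : species -> R) (i : species) : R :=
  total_conc M x * x i.

(* Detailed-balanced equilibrium of A1 + A2 <-> A3 with unit rate constants.
   The balance law is written in the mole fractions, not the concentrations. *)
Record equilibrium (M : species -> R) (M13 M23 : R) (x : species -> R) : Prop :=
  { eq_range : forall i, 0 < x i < 1;
    eq_balance : x Sp1 * x Sp2 = x Sp3;
    eq_fractions : sum_species x = 1;
    eq_M13 : conc M x Sp1 + conc M x Sp3 = M13;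
    eq_M23 : conc M x Sp2 + conc M x Sp3 = M23 }.

(* Formulas in the equilibrium concentrations and in upper bounds of
   the concentrations.  Such a formula, when [well_defined], is what an
   explicitly computable constant depending only on these six numbers is
   taken to be. *)
Inductive formula : Set :=
  | FConst (z : Z)
  | FCinf (i : species)
  | FBound (i : species)
  | FAdd (e f : formula)
  | FSub (e f : formula)
  | FMul (e f : formula)
  | FDiv (e f : formula)
  | FSqrt (e : formula)
  | FMin (e f : formula)
  | FMax (e f : formula).

Fixpoint eval (cinf K : species -> R) (e : formula) : R :=
  match e with
  | FConst z => IZR z
  | FCinf i => cinf i
  | FBound i => K i
  | FAdd e f => eval cinf K e + eval cinf K f
  | FSub e f => eval cinf K e - eval cinf K f
  | FMul e f => eval cinf K e * eval cinf K f
  | FDiv e f => eval cinf K e / eval cinf K f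
  | FSqrt e => sqrt (eval cinf K e)
  | FMin e f => Rmin (eval cinf K e) (eval cinf K f)
  | FMax e f => Rmax (eval cinf K e) (eval cinf K f)
  end.

(* [/] and [sqrt] are total functions, so a formula could otherwise exploit
   their values outside the natural domain, e.g. to decide equality of reals
   by x / x, which is not computable. *)
Fixpoint well_defined (cinf K : species -> R) (e : formula) : Prop :=
  match e with
  | FConst _ | FCinf _ | FBound _ => True
  | FAdd e f | FSub e f | FMul e f | FMin e f | FMax e f =>
      well_defined cinf K e /\ well_defined cinf K f
  | FDiv e f =>
      well_defined cinf K e /\ well_defined cinf K f /\ eval cinf K f <> 0
  | FSqrt e => well_defined cinf K e /\ 0 <= eval cinf K e
  end.

(* Main.v *)
(** Write [a i] for the equilibrium concentrations, [a] for their sum and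
    [t = c3 - a3].  The conservation laws give [c1 = a1 - t], [c2 = a2 - t] and
    [c = a - t], and the balance [a1 a2 = a3 a] turns [c1 c2 - c3 c] into
    [- 2 t (a1 + c2)], of size at least [2 a1 |t|].  Dividing by the conjugate
    [sqrt (c1 c2) + sqrt (c3 c)], which is at most [2 (a1 + a2 + 2 a3)], bounds
    the left-hand side below by a multiple of [t^2], while each
    [(sqrt (c i) - sqrt (a i))^2] is at most [t^2 / a i]. *)

Require Import Defs.
From Stdlib Require Import Reals.
From Stdlib Require Import Lra.
Open Scope R_scope.

(** Factor [c - a] as [(sqrt c - sqrt a) * (sqrt c + sqrt a)]; the square of the second factor is at
    least [a]. *)
Lemma sqr_sqrt_sub_le (a c : R) :
  0 < a -> 0 <= c -> (sqrt c - sqrt a) ^ 2 <= (c - a) ^ 2 / a.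
Proof.
  intros Ha Hc.
  assert (Hu := sqrt_pos c). assert (Hv := sqrt_lt_R0 a Ha).
  assert (Eu := sqrt_sqrt c Hc). assert (Ev := sqrt_sqrt a (Rlt_le _ _ Ha)).
  apply Rmult_le_reg_r with a; [exact Ha |].
  replace ((c - a) ^ 2 / a * a) with ((c - a) ^ 2) by (field; lra).
  (* Occurrence 3 is the one outside the square roots. *)
  replace ((c - a) ^ 2) with ((sqrt c - sqrt a) ^ 2 * (sqrt c + sqrt a) ^ 2)
    by (rewrite <- Eu at 3; rewrite <- Ev at 3; ring).
  apply Rmult_le_compat_l; [apply pow2_ge_0 | nra].
Qed.

(** The conjugate factor [sqrt p + sqrt q] is at most [2 * B]. *)
Lemma sqr_sub_le_sqrt (p q B : R) :
  0 <= B -> 0 <= p <= B ^ 2 -> 0 <= q <= B ^ 2 ->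
  (p - q) ^ 2 <= 4 * B ^ 2 * (sqrt p - sqrt q) ^ 2.
Proof.
  intros HB [Hp HpB] [Hq HqB].
  assert (Hu := sqrt_pos p). assert (Hv := sqrt_pos q).
  assert (Eu := sqrt_sqrt p Hp). assert (Ev := sqrt_sqrt q Hq).
  assert (HuB := sqrt_le_1_alt _ _ HpB). assert (HvB := sqrt_le_1_alt _ _ HqB).
  rewrite (sqrt_pow2 B HB) in HuB, HvB.
  replace ((p - q) ^ 2) with ((sqrt p + sqrt q) ^ 2 * (sqrt p - sqrt q) ^ 2)
    by (rewrite <- Eu at 3; rewrite <- Ev at 3; ring).
  apply Rmult_le_compat_r; [apply pow2_ge_0 |].
  replace (4 * B ^ 2) with ((2 * B) ^ 2) by ring.
  apply pow_incr; lra.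
Qed.

Lemma equilibrium_conc_pos (M : species -> R) (M13 M23 : R) (x : species -> R) :
  (forall i, 0 < M i) -> equilibrium M M13 M23 x -> forall i, 0 < conc M x i.
Proof.
  intros HM [Hx _ _ _ _] i; unfold conc, total_conc, sum_species.
  assert (H : forall j, 0 < M j * x j)
    by (intro j; apply Rmult_lt_0_compat; [apply HM | apply Hx]).
  apply Rmult_lt_0_compat; [| apply Hx].
  apply Rinv_0_lt_compat.
  generalize (H Sp1) (H Sp2) (H Sp3); lra.
Qed.

(** Since the fractions sum to one, [x1 x2 = x3] has the homogeneous form
    [x1 x2 = x3 (x1 + x2 + x3)], which survives scaling by the total concentration. *)
Lemma equilibrium_conc_balance
  (M : species -> R) (M13 M23 : R) (x : species -> R) :
  equilibrium M M13 M23 x ->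
  conc M x Sp1 * conc M x Sp2 = conc M x Sp3 * sum_species (conc M x).
Proof.
  intros [_ Hb Hs _ _]; unfold sum_species in Hs.
  unfold sum_species, conc; rewrite <- !Rmult_plus_distr_l, Hs, <- Hb; ring.
Qed.

(** Quotient of the lower bound [2 a1 |t|] for the difference of products by the bound
    [2 (a1 + a2 + 2 a3)] for its conjugate. *)
Definition rate (a : species -> R) : R :=
  a Sp1 / (a Sp1 + a Sp2 + 2 * a Sp3).

Definition gap_constant (a : species -> R) : R :=
  rate a * rate a / sum_species (fun i => 1 / a i).

Lemma gap_constant_pos (a : species -> R) :
  (forall i, 0 < a i) -> 0 < gap_constant a.
Proof.
  intros Ha; unfold gap_constant, sum_species.
  assert (Hi : forall i, 0 < 1 / a i)
    by (intro i; apply Rdiv_lt_0_compat; [lra | apply Ha]).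
  assert (Hr : 0 < rate a)
    by (apply Rdiv_lt_0_compat; generalize (Ha Sp1) (Ha Sp2) (Ha Sp3); lra).
  apply Rdiv_lt_0_compat; [now apply Rmult_lt_0_compat |].
  generalize (Hi Sp1) (Hi Sp2) (Hi Sp3); lra.
Qed.

Lemma gap_constant_bound (a c : species -> R) :
  (forall i, 0 < a i) -> (forall i, 0 <= c i) ->
  a Sp1 * a Sp2 = a Sp3 * sum_species a ->
  c Sp1 + c Sp3 = a Sp1 + a Sp3 -> c Sp2 + c Sp3 = a Sp2 + a Sp3 ->
  gap_constant a * sum_species (fun i => (sqrt (c i) - sqrt (a i)) ^ 2) <=
  (sqrt (c Sp1) * sqrt (c Sp2) - sqrt (c Sp3) * sqrt (sum_species c)) ^ 2.
Proof.
  intros Ha Hc Hbal H13 H23.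
  assert (Hub := fun i => sqr_sqrt_sub_le (a i) (c i) (Ha i) (Hc i)).
  assert (Hinv : forall i, 0 < 1 / a i)
    by (intro i; apply Rdiv_lt_0_compat; [lra | apply Ha]).
  unfold gap_constant, rate, sum_species in *.
  generalize (Ha Sp1) (Ha Sp2) (Ha Sp3) (Hc Sp1) (Hc Sp2) (Hc Sp3); intros.
  generalize (Hub Sp1) (Hub Sp2) (Hub Sp3)
    (Hinv Sp1) (Hinv Sp2) (Hinv Sp3); intros.
  clear Ha Hc Hub Hinv.
  set (t := c Sp3 - a Sp3).
  assert (E1 : c Sp1 - a Sp1 = - t) by (unfold t; lra).
  assert (E2 : c Sp2 - a Sp2 = - t) by (unfold t; lra).
  assert (E3 : c Sp3 - a Sp3 = t) by reflexivity.
  set (B := a Sp1 + a Sp2 + 2 * a Sp3).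
  assert (HB : 0 < B) by (unfold B; lra).
  set (I := 1 / a Sp1 + 1 / a Sp2 + 1 / a Sp3).
  assert (HI : 0 < I) by (unfold I; lra).
  set (S := _ + _ + _ : R).
  assert (HS : S <= t ^ 2 * I).
  { replace (t ^ 2 * I) with
      ((- t) ^ 2 / a Sp1 + (- t) ^ 2 / a Sp2 + t ^ 2 / a Sp3)
      by (unfold I; field; lra).
    (* The first [- t] belongs to species 1, the remaining one to species 2. *)
    rewrite <- E1 at 1; rewrite <- E2, <- E3; unfold S; lra. }
  rewrite <- !sqrt_mult by lra.
  set (p := c Sp1 * c Sp2).
  set (q := c Sp3 * (c Sp1 + c Sp2 + c Sp3)).
  (* By conservation [B] equals [(c1 + c3) + (c2 + c3)], so it dominates each concentration and
     their sum. *)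
  assert (Hp : 0 <= p <= B ^ 2) by (unfold p, B; split; nra).
  assert (Hq : 0 <= q <= B ^ 2).
  { unfold q; split; [nra |].
    replace (B ^ 2) with (B * B) by ring.
    apply Rmult_le_compat; unfold B; lra. }
  assert (Hlb := sqr_sub_le_sqrt p q B (Rlt_le _ _ HB) Hp Hq).
  assert (Epq : p - q = - 2 * t * (a Sp1 + c Sp2)).
  { unfold p, q.
    replace (c Sp1) with (a Sp1 - t) by lra.
    replace (c Sp2) with (a Sp2 - t) by lra.
    replace (c Sp3) with (a Sp3 + t) by lra.
    (* The terms free of [t] cancel by [Hbal], leaving [- 2 t (a1 + a2 - t)]. *)
    nra. }
  assert (Hpq : 4 * t ^ 2 * a Sp1 ^ 2 <= (p - q) ^ 2).
  { rewrite Epq.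
    replace ((- 2 * t * (a Sp1 + c Sp2)) ^ 2)
      with (4 * t ^ 2 * (a Sp1 + c Sp2) ^ 2) by ring.
    apply Rmult_le_compat_l; [nra | apply pow_incr; lra]. }
  apply Rle_trans with (a Sp1 / B * (a Sp1 / B) / I * (t ^ 2 * I)).
  - apply Rmult_le_compat_l; [| exact HS].
    assert (0 < a Sp1 / B) by (now apply Rdiv_lt_0_compat).
    apply Rlt_le, Rdiv_lt_0_compat; [now apply Rmult_lt_0_compat | exact HI].
  (* [I] cancels, and clearing [4 * B ^ 2] leaves [Hpq] chained with [Hlb]. *)
  - apply Rmult_le_reg_l with (4 * B ^ 2); [nra |].
    replace (4 * B ^ 2 * (a Sp1 / B * (a Sp1 / B) / I * (t ^ 2 * I)))
      with (4 * t ^ 2 * a Sp1 ^ 2) by (field; lra).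
    lra.
Qed.

(** Syntax tree mirroring [gap_constant], so that its evaluation is convertible to that number. *)
Definition gap_formula : formula :=
  let r := FDiv (FCinf Sp1)
    (FAdd (FAdd (FCinf Sp1) (FCinf Sp2)) (FMul (FConst 2) (FCinf Sp3))) in
  let inv i := FDiv (FConst 1) (FCinf i) in
  FDiv (FMul r r) (FAdd (FAdd (inv Sp1) (inv Sp2)) (inv Sp3)).

Lemma gap_formula_well_defined (a K : species -> R) :
  (forall i, 0 < a i) -> well_defined a K gap_formula.
Proof.
  intros Ha; simpl.
  assert (Hi : forall i, 0 < 1 / a i)
    by (intro i; apply Rdiv_lt_0_compat; [lra | apply Ha]).
  generalize (Ha Sp1) (Ha Sp2) (Ha Sp3) (Hi Sp1) (Hi Sp2) (Hi Sp3); intros.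
  repeat split; lra.
Qed.

Theorem lemma26 :
  exists C0 : formula,
    forall (M : species -> R) (M13 M23 : R) (xinf : species -> R),
      (forall i, 0 < M i) -> M Sp1 + M Sp2 = M Sp3 ->
      0 < M13 -> 0 < M23 -> M Sp1 * M13 + M Sp2 * M23 = 1 ->
      equilibrium M M13 M23 xinf ->
      forall K : species -> R, (forall i, 0 <= K i) ->
        well_defined (conc M xinf) K C0 /\
        0 < eval (conc M xinf) K C0 /\
        forall (c : species -> R) (ctot : R),
          (forall i, 0 <= c i) -> 0 <= ctot ->
          (forall i, c i <= K i) ->
          c Sp1 + c Sp3 = M13 ->
          c Sp2 + c Sp3 = M23 ->
          sum_species c = ctot ->
          (sqrt (c Sp1) * sqrt (c Sp2) - sqrt (c Sp3) * sqrt ctot) ^ 2 >=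
          eval (conc M xinf) K C0 *
          sum_species (fun i => (sqrt (c i) - sqrt (conc M xinf i)) ^ 2).
Proof.
  exists gap_formula.
  intros M M13 M23 xinf HM _ _ _ _ Heq K _.
  assert (Ha := equilibrium_conc_pos _ _ _ _ HM Heq).
  change (eval (conc M xinf) K gap_formula)
    with (gap_constant (conc M xinf)).
  split; [now apply gap_formula_well_defined |].
  split; [now apply gap_constant_pos |].
  intros c ctot Hc _ _ H13 H23 <-.
  apply Rle_ge, gap_constant_bound; try assumption.
  - exact (equilibrium_conc_balance _ _ _ _ Heq).
  - now rewrite (eq_M13 _ _ _ _ Heq).
  - now rewrite (eq_M23 _ _ _ _ Heq).
Qed.
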